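(* (i) Let $a,b$ be integers with $b\geq 2$ and $1\leq a<b$. Then the set $$\{\mathbf{IKM}(a,b;2k+1)\mid k\in\mathbb Z\cap[0,(a+b-1)/2]\}$$ is linearly dependent over $\mathbb Q$, and $$\dim_{\mathbb Q}\operatorname{span}_{\mathbb Q}\{\mathbf{IKM}(a,b;2k+1)\mid k\in\mathbb Z_{\geq0}\}\leq\lfloor(a+b-1)/2\rfloor.$$ (ii) Let $n\geq 2$ be an integer. Then the set $$\{1\}\cup\{\mathbf{IKM}(0,n;2k+1)\mid k\in\mathbb Z\cap[0,(n-1)/2]\}$$ is linearly dependent over $\mathbb Q$, and $$\dim_{\mathbb Q}\operatorname{span}_{\mathbb Q}\{\mathbf{IKM}(0,n;2k+1)\mid k\in\mathbb Z_{\geq0}\}\leq\lfloor(n+1)/2\rfloor.$$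
   Context: For $t>0$, the modified Bessel functions of order zero are $I_0(t)=\frac1\pi\int_0^\pi e^{t\cos\theta}\,d\theta$ and $K_0(t)=\int_0^\infty e^{-t\cosh u}\,du$. For non-negative integers $a,b,k$ for which the integral converges, the Bessel moment is $$\mathbf{IKM}(a,b;2k+1):=\int_0^\infty [I_0(t)]^a[K_0(t)]^b t^{2k+1}\,dt .$$ $\lfloor x\rfloor$ denotes the greatest integer less than or equal to $x$. Linear dependence of a set given by an indexed list refers to the indexed family: there is a nontrivial rational linear relation among the listed numbers. *)

(* Defs.v *)
From HB Require Import structures.
From mathcomp Require Import all_boot all_order all_algebra.
From mathcomp Require Import all_classical all_reals all_analysis.

Set Implicit Arguments.
Unset Strict Implicit.
Unset Printing Implicit Defensive.

Import Order.TTheory GRing.Theory Num.Theory.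
Import numFieldNormedType.Exports.

Local Open Scope classical_set_scope.
Local Open Scope ring_scope.

Section BesselMoments.
Variable R : realType.
Local Notation mu := (@lebesgue_measure R).

Definition cosh (u : R) : R := (expR u + expR (- u)) / 2.

Definition besselI0 (t : R) : R :=
  pi^-1 * \int[mu]_(x in `[0, pi]) expR (t * cos x).

(* Meaningful for t > 0 only: [Rintegral] returns 0 on a divergent integral. *)
Definition besselK0 (t : R) : R :=
  \int[mu]_(u in `[0, +oo[) expR (- t * cosh u).

(* The argument [m] is the exponent of t, so IKM(a,b;2k+1) is [IKM a b k.*2.+1].
   The integral converges for every m when a < b, in particular when a = 0 and
   b >= 1. *)
Definition IKM (a b m : nat) : R :=
  \int[mu]_(t in `]0, +oo[) (besselI0 t ^+ a * besselK0 t ^+ b * t ^+ m).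

End BesselMoments.

Section RationalLinearAlgebra.
Variable R : realType.

(* Dependence is a property of the indexed family: repeated values count. *)
Definition Qdependent (I : finType) (f : I -> R) : Prop :=
  exists2 c : I -> rat,
    (exists i, c i != 0) & \sum_(i : I) ratr (c i) * f i = 0.

Definition Qspan (A : set R) : set R :=
  [set x | exists (n : nat) (c : 'I_n -> rat) (v : 'I_n -> R),
     (forall i, A (v i)) /\ x = \sum_(i < n) ratr (c i) * v i].

Definition Qbasis (n : nat) (V : set R) (e : 'I_n -> R) : Prop :=
  ~ Qdependent e /\ Qspan (range e) = V.

(* V is finite-dimensional over Q and its dimension is at most d. *)
Definition Qdim_le (V : set R) (d : nat) : Prop :=
  exists (n : nat) (e : 'I_n -> R), Qbasis V e /\ (n <= d)%N.

End RationalLinearAlgebra.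

(* Main.v *)
Require Import Defs.
From HB Require Import structures.
From mathcomp Require Import all_boot all_order all_algebra.
From mathcomp Require Import all_classical all_reals all_analysis.
From mathcomp Require Import measurable_realfun lebesgue_integral_under.
From mathcomp Require Import zify ring lra.

Set Implicit Arguments.
Unset Strict Implicit.
Unset Printing Implicit Defensive.

Import Order.TTheory GRing.Theory Num.Theory.
Import numFieldNormedType.Exports.

Local Open Scope classical_set_scope.
Local Open Scope ring_scope.

(** Let theta = t d/dt.  Both I_0 and K_0 satisfy theta^2 f = t^2 f, so each
    linear polynomial f + (theta f) X, for f = I_0 or K_0, solves the same
    first-order equation in t and X; this equation is compatible with products.
    For n = a + b and
      P(X) = (I_0 + (theta I_0) X)^a (K_0 + (theta K_0) X)^b = sum_j g_j X^j
    it reads ([is_derive_bcoef])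
      theta g_j = (j + 1) g_{j+1} + (n - j + 1) t^2 g_{j-1},
    where g_0 = I_0^a K_0^b, g_n = (theta I_0)^a (theta K_0)^b and g_{n+1} = 0.

    Put M_j(m) = int_0^oo t^m g_j dt, so that M_0(m) = IKM(a,b;m).  When a < b
    these integrals converge for m >= 1, and integrating the derivative of
    t^{m+1} g_j gives ([moment_rec])
      (m + 1) M_j(m) + (j + 1) M_{j+1}(m) + (n - j + 1) M_{j-1}(m + 2) = 0.
    By induction on j, M_j(2k+1) is a rational combination of the first
    floor(j/2) + 1 moments c_k, c_{k+1}, ..., where c_k = IKM(a,b;2k+1), and a
    sign count shows that the last coefficient is not zero
    ([moment_shiftop]).  Two values of j are of interest, with
    K = floor((n - 1)/2):
    - j = n + 1: M_{n+1} = 0 expresses c_{k+K+1} through c_k, ..., c_{k+K}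
      ([IKM_rec]), so c_0, ..., c_K span everything;
    - j = n - 1, k = 0: integrating the derivative of g_n itself, which is
      t g_{n-1}, gives M_{n-1}(1) = - lim_{t -> 0} g_n(t)
      ([moment_top], [IKM_extra]).  Since theta I_0 -> 0 and theta K_0 -> -1,
      this is 0 if a >= 1 and - (-1)^b if a = 0, which is the announced linear
      relation between c_0, ..., c_K, with the number 1 involved when a = 0.
      For a >= 1 it also expresses c_K through c_0, ..., c_{K-1}, and the
      bound on the dimension drops by one.

    The analytic part establishes the Bessel equation by differentiation
    under the integral sign, and bounds I_0, K_0 and their images under theta
    at 0 and at infinity well enough to dominate t^m g_j, for m >= 1, by a
    multiple of e^{-t/2} ([bcoef_bound]). *)

(** * Integration on a half-line *)

Section Calculus.
Context {R : realType}.
Local Notation mu := (@lebesgue_measure R).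

Lemma integrable_realD (D : set R) (f g : R -> R) : measurable D ->
  mu.-integrable D (EFin \o f) -> mu.-integrable D (EFin \o g) ->
  mu.-integrable D (EFin \o (fun x => f x + g x)).
Proof.
by move=> mD intf intg; exact: (@integrableD _ _ _ mu D mD _ _ intf intg).
Qed.

Lemma integrable_realZ (D : set R) (k : R) (f : R -> R) : measurable D ->
  mu.-integrable D (EFin \o f) -> mu.-integrable D (EFin \o (fun x => k * f x)).
Proof. by move=> mD intf; exact: (@integrableZl _ _ _ mu D mD k _ intf). Qed.

(** The integral over [1/(n+1), n+2] is given by the fundamental theorem of
    calculus on a segment, and tends to the integral over the half-line by
    dominated convergence, the integrand itself being the dominating function.
    Unlike its counterparts for nonnegative integrands, this version allows
    sign changes and a singularity at 0. *)
Lemma FTC_itv0y (f F : R -> R) (l0 ly : R) :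
  (forall x : R, 0 < x -> is_derive x (1 : R) F (f x)) ->
  (forall x : R, 0 < x -> {for x, continuous f}) ->
  mu.-integrable `]0, +oo[ (EFin \o f) ->
  F x @[x --> 0^'+] --> l0 -> F x @[x --> +oo] --> ly ->
  \int[mu]_(x in `]0, +oo[) f x = ly - l0.
Proof.
move=> dF cf intf F0 Fy.
pose A n := [set` `[n.+1%:R^-1, n.+2%:R : R]].
have A0y n : A n `<=` `]0, +oo[.
  move=> x; rewrite /A/= !in_itv/= andbT => /andP[+ _].
  by apply: lt_le_trans; rewrite invr_gt0.
have mA n : measurable (A n) by exact: measurable_itv.
have ltA n : n.+1%:R^-1 < n.+2%:R :> R.
  apply: (@le_lt_trans _ _ 1); first by rewrite invf_le1 ?ler1n.
  by rewrite ltr1n.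
have FTC n : \int[mu]_(x in A n) f x = F n.+2%:R - F n.+1%:R^-1.
  have pos (x : R) : n.+1%:R^-1 <= x -> 0 < x by apply: lt_le_trans; rewrite invr_gt0.
  rewrite /Rintegral (@continuous_FTC2 _ f F)//.
  - apply: continuous_in_subspaceT => x /set_mem/=; rewrite in_itv/= => /andP[x0 _].
    exact/cf/pos.
  - have cF x : n.+1%:R^-1 <= x -> {for x, continuous F}.
      move=> x0; have [dx _] := dF x (pos _ x0).
      exact/differentiable_continuous/derivable1_diffP.
    split.
    + by move=> x; rewrite in_itv/= => /andP[/ltW/pos x0 _]; have [] := dF x x0.
    + by apply: cvg_at_right_filter; apply: cF.
    + by apply: cvg_at_left_filter; apply: cF; apply: ltW.
  - move=> x; rewrite in_itv/= => /andP[/ltW/pos x0 _].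
    by rewrite derive1E; apply: derive_val; exact: dF.
have lim1 : \int[mu]_(x in A n) f x @[n --> \oo] --> ly - l0.
  under eq_fun do rewrite FTC.
  apply: cvgB.
    apply: (cvg_comp _ _ _ Fy).
    have := @cvgr_idn R; rewrite -(cvg_shiftn 2).
    by under eq_fun do rewrite addn2.
  move/cvg_at_rightP : F0; apply; split; first by move=> n; rewrite invr_gt0.
  exact: cvg_harmonic.
have lim2 : \int[mu]_(x in A n) f x @[n --> \oo] --> \int[mu]_(x in `]0, +oo[) f x.
  under eq_fun do rewrite /Rintegral.
  apply: fine_cvg; rewrite fineK; last exact: integrable_fin_num.
  have -> : (fun n => (\int[mu]_(x in A n) (f x)%:E)%E) =
     (fun n => (\int[mu]_(x in `]0%R, +oo[) ((f \_ (A n)) x)%:E)%E).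
    apply/funext => n.
    by rewrite -[in LHS](setIidr (@A0y n)) integral_mkcondr restrict_EFin.
  apply: (@dominated_cvg _ _ _ mu _ _ _ _ (abse \o (EFin \o f))) => //.
  - move=> n; apply/measurable_EFinP.
    apply/(measurable_restrict _ (mA n) (measurable_itv _)).
    apply: (measurable_funS (measurable_itv `]0, +oo[) (@subIsetl _ _ _)).
    by apply/measurable_EFinP; exact: (measurable_int mu intf).
  - move=> x /=; rewrite in_itv/= andbT => x0.
    apply: cvg_near_cst; near=> n; rewrite patchE ifT//.
    rewrite inE /A/= in_itv/=; apply/andP; split.
      rewrite -[leRHS]invrK lef_pV2 ?posrE ?invr_gt0//.
      apply: (@le_trans _ _ n%:R); last by rewrite ler_nat.
      by apply/ltW; near: n; exact: nbhs_infty_gtr.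
    apply: (@le_trans _ _ n%:R); last by rewrite ler_nat leqW.
    by apply/ltW; near: n; exact: nbhs_infty_gtr.
  - exact: integrable_abse.
  - move=> n x _ /=; rewrite patchE; case: ifPn => //= _; rewrite normr0 lee_fin//.
exact: (cvg_unique _ lim2 lim1).
Unshelve. all: by end_near. Qed.

Lemma cvgy_expRN (r : R) : 0 < r -> expR (- r * x) @[x --> +oo] --> 0.
Proof.
move=> r0; under eq_fun do rewrite mulNr.
apply: (@cvg_comp _ _ _ (fun x => r * x) (fun y => expR (- y)) _ +oo _ _
  (@cvgr_expR R)).
by apply: gt0_cvgMry => //; exact: cvg_id.
Qed.

Lemma integrable_expRN (r : R) : 0 < r ->
  mu.-integrable `[0, +oo[ (EFin \o (fun x => expR (- r * x))).
Proof.
move=> r0.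
have cexp : continuous (fun x : R => expR (- r * x)).
  move=> x; apply: continuous_comp; last exact: continuous_expR.
  by apply: cvgM; [exact: cvg_cst|exact: cvg_id].
apply/integrableP; split.
  by apply/measurable_EFinP/measurable_funTS; exact: continuous_measurable_fun.
under eq_integral do rewrite /= ger0_norm ?expR_ge0//.
pose F (x : R) := (- r)^-1 * expR (- r * x).
have dF (x : R) : is_derive x 1 F (expR (- r * x)).
  have h : is_derive x 1 (fun x => - r * x) (- r).
    by apply: is_derive_eq; rewrite /GRing.scale/= mulr1.
  have h2 := is_deriveZ (- r)^-1 (is_derive1_comp (is_derive_expR _) h).
  apply: (is_derive_eq h2); rewrite /GRing.scale/=; field; lra.
have cF : continuous F.
  by move=> x; apply/differentiable_continuous/derivable1_diffP; case: (dF x).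
rewrite (@ge0_continuous_FTC2y _ _ F 0 0).
- by rewrite -EFinB ltry.
- by move=> x _; exact: expR_ge0.
- by apply: continuous_subspaceT.
- rewrite -[X in _ --> X](mulr0 (- r)^-1).
  by apply: cvgM; [exact: cvg_cst|exact: cvgy_expRN].
- by move=> x _; case: (dF x).
- by apply: cvg_at_right_filter; exact: cF.
- by move=> x _; rewrite derive1E; case: (dF x).
Qed.

Lemma le_expRN_integrable (D : set R) (f : R -> R) (C r : R) :
  measurable D -> D `<=` `[0, +oo[ -> measurable_fun D f -> 0 < r ->
  (forall x, D x -> `|f x| <= C * expR (- r * x)) ->
  mu.-integrable D (EFin \o f).
Proof.
move=> mD D0 mf r0 fC.
have intg : mu.-integrable D (EFin \o (fun x => C * expR (- r * x))).
  apply: integrable_realZ => //.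
  apply: (@integrableS _ _ _ mu `[0, +oo[) => //; exact: integrable_expRN.
apply: (@le_integrable _ _ _ mu D mD _ _ _ _ intg).
  exact/measurable_EFinP.
move=> x Dx /=; rewrite lee_fin (le_trans (fC x Dx))//.
exact: ler_norm.
Qed.

Lemma le_expRN_cvgy (f : R -> R) (C r : R) : 0 < r ->
  (forall x, 1 <= x -> `|f x| <= C * expR (- r * x)) ->
  f x @[x --> +oo] --> 0.
Proof.
move=> r0 fC; apply: norm_cvg0.
apply: (@squeeze_cvgr _ _ _ _ (cst 0) (fun x => C * expR (- r * x))).
- by near=> x; rewrite normr_ge0/= fC.
- exact: cvg_cst.
- rewrite -[X in _ --> X](mulr0 C).
  by apply: cvgM; [exact: cvg_cst|exact: cvgy_expRN].
Unshelve. all: by end_near. Qed.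

End Calculus.

(** * Derivatives of real functions *)

Section Derivatives.
Context {R : realType}.
Implicit Types (f g : R -> R) (x df dg : R).

Lemma is_derive_mul f g x df dg : is_derive x 1 f df -> is_derive x 1 g dg ->
  is_derive x 1 (fun t => f t * g t) (df * g x + f x * dg).
Proof.
move=> hf hg; apply: (is_derive_eq (is_deriveM hf hg)).
by rewrite /GRing.scale/=; ring.
Qed.

Lemma is_derive_expcomp f x df : is_derive x 1 f df ->
  is_derive x 1 (fun t => expR (f t)) (expR (f x) * df).
Proof. exact: is_derive1_comp. Qed.

Lemma is_derive_continuous f x df : is_derive x 1 f df -> {for x, continuous f}.
Proof. by case=> dx _; apply/differentiable_continuous/derivable1_diffP. Qed.

Lemma is_derive_pow n x : is_derive x 1 (fun t : R => t ^+ n) (n%:R * x ^+ n.-1).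
Proof.
rewrite (_ : (fun _ => _) = id ^+ n); last by apply/funext => t; rewrite exprfctE.
by apply: is_derive_eq; rewrite /GRing.scale/= mulr1.
Qed.

End Derivatives.

(** * Integrals with an exponential kernel *)

Section ExponentialKernel.
Context {R : realType}.
Local Notation mu := (@lebesgue_measure R).

(** For k = 0 this is K_0 when p = cosh on [0, +oo[ and pi I_0 when p = - cos
    on [0, pi]; increasing k differentiates in t, up to sign. *)
Definition laplace (D : set R) (p : R -> R) (k : nat) (t : R) : R :=
  \int[mu]_(u in D) (p u ^+ k * expR (- t * p u)).

Variables (D : set R) (p : R -> R).
Hypothesis mD : measurable D.
Hypothesis p_geN1 : forall u, -1 <= p u.
Hypothesis intp : forall k (t : R), 0 < t ->
  mu.-integrable D (EFin \o (fun u => p u ^+ k * expR (- t * p u))).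

(** Differentiation under the integral sign at t, for parameters s in
    ]t/2, 2t[: as p >= -1, the factor e^{-(s - t/2) p} is at most e^{2t}, so
    that the integrand at t/2 dominates. *)
Lemma is_derive_laplace k (t : R) : 0 < t ->
  is_derive t 1 (laplace D p k) (- laplace D p k.+1 t).
Proof.
move=> t0.
pose f (s u : R) := p u ^+ k * expR (- s * p u).
have df (s u : R) : is_derive s 1 (f ^~ u) (- (p u ^+ k.+1 * expR (- s * p u))).
  have h1 : is_derive s 1 (fun s => - s * p u) (- p u).
    have h0 := is_derive_mul (is_deriveNid s 1) (is_derive_cst (p u) s 1).
    by apply: is_derive_eq; rewrite mulr0 addr0 mulN1r.
  have h2 := is_derive_mul (is_derive_cst (p u ^+ k) s 1) (is_derive_expcomp h1).
  by apply: is_derive_eq; rewrite exprS /cst; ring.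
pose G u := expR (t * 2) * `|p u ^+ k.+1 * expR (- (t / 2) * p u)|.
have H : h^-1 *: (laplace D p k (h + t) - laplace D p k t) @[h --> 0^'] -->
     \int[mu]_(u in D) partial1of2 f t u.
  apply: (@cvg_differentiation_under_integral _ _ _ mu f D mD
    t (t / 2) (t * 2) _ _ _ G).
  - by rewrite /= in_itv/=; lra.
  - by move=> x; rewrite /= in_itv/= => xt; apply: intp; lra.
  - by move=> x u _ _; case: (df x u).
  - by move=> u; rewrite mulr_ge0// expR_ge0.
  - rewrite [X in _.-integrable _ X](_ : _ = fun u => ((expR (t * 2))%:E *
      (`|p u ^+ k.+1 * expR (- (t / 2) * p u)|)%:E)%E)//.
    apply: integrableZl => //.
    have /integrable_norm// := @intp k.+1 (t / 2) ltac:(lra).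
  - move=> x u; rewrite /= in_itv/= => xt Du.
    have [_] := df x u; rewrite /partial1of2 derive1E => ->.
    rewrite normrN /G !normrM mulrCA ler_wpM2l// !ger0_norm ?expR_ge0//.
    rewrite -expRD ler_expR; have := p_geN1 u; nra.
have Hd : \int[mu]_(u in D) partial1of2 f t u = - laplace D p k.+1 t.
  rewrite -mulN1r -RintegralZl//; last exact: intp.
  apply: eq_Rintegral => u _; have [_] := df t u.
  by rewrite /partial1of2 derive1E => ->; rewrite mulN1r.
rewrite -Hd.
have {}H : h^-1 *: (laplace D p k (h *: 1 + t) - laplace D p k t) @[h --> 0^'] -->
     \int[mu]_(u in D) partial1of2 f t u.
  by under eq_fun do rewrite scaler1; exact: H.
apply: DeriveDef; first by apply/cvg_ex; eexists; exact: H.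
exact: (cvg_lim (@Rhausdorff R) H).
Qed.

(** The Bessel equation theta^2 f = t^2 f, with theta = t d/dt, written as the
    first-order system theta f = phi, theta phi = t^2 f. *)
Definition bessel_pair (f phi : R -> R) := forall t : R, 0 < t ->
  is_derive t 1 f (phi t / t) /\ is_derive t 1 phi (t * f t).

(** For p = cosh and for p = - cos the integrand is the derivative in u of
    p'(u) e^{-t p(u)} up to sign, and p' vanishes at the ends where the
    exponential does not. *)
Hypothesis ibp : forall t : R, 0 < t ->
  \int[mu]_(u in D) ((p u - t * (p u ^+ 2 - 1)) * expR (- t * p u)) = 0.

Lemma laplace_bessel_pair :
  bessel_pair (laplace D p 0) (fun t => - t * laplace D p 1 t).
Proof.
move=> t t0; split.
  have h := is_derive_laplace 0 t0.
  by apply: is_derive_eq; field; rewrite gt_eqF.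
have h := is_derive_mul (is_deriveNid t 1) (is_derive_laplace 1 t0).
apply: is_derive_eq.
have intZ k r : mu.-integrable D
    (EFin \o (fun u => r * (p u ^+ k * expR (- t * p u)))).
  by apply: integrable_realZ => //; exact: intp.
have : laplace D p 1 t + ((- t) * laplace D p 2 t + t * laplace D p 0 t) = 0.
  rewrite -[RHS](ibp t0) /laplace -!RintegralZl//; try exact: intp.
  rewrite -RintegralD//; [|exact: intZ..].
  rewrite -RintegralD//; [|exact: intp|].
    by apply: eq_Rintegral => u _; ring.
  by apply: integrable_realD => //; exact: intZ.
by move/eqP; rewrite addrA addr_eq0 -mulN1r => /eqP; lra.
Qed.

End ExponentialKernel.

(** * The Bessel functions of order zero *)

Section Bessel.
Context {R : realType}.
Local Notation mu := (@lebesgue_measure R).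

Lemma bessel_pairZ (c : R) (f phi : R -> R) : bessel_pair f phi ->
  bessel_pair (fun t => c * f t) (fun t => c * phi t).
Proof.
move=> fphi t t0; have [h1 h2] := fphi t t0; split.
  have := is_derive_mul (is_derive_cst c t 1) h1.
  by move=> h; apply: is_derive_eq; rewrite mul0r add0r /cst; ring.
have := is_derive_mul (is_derive_cst c t 1) h2.
by move=> h; apply: is_derive_eq; rewrite mul0r add0r /cst; ring.
Qed.

Local Notation lapI := (laplace `[0, pi] (fun u : R => - cos u)).
Local Notation lapK := (laplace `[0, +oo[ (@cosh R)).

Lemma continuous_cosh : continuous (@cosh R).
Proof.
move=> u; apply: cvgM; last exact: cvg_cst.
apply: cvgD; first exact: continuous_expR.
apply: continuous_comp; first exact: opp_continuous.
exact: continuous_expR.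
Qed.

Lemma continuous_kernel (p : R -> R) k (t : R) : continuous p ->
  continuous (fun u => p u ^+ k * expR (- t * p u)).
Proof.
move=> cp u; apply: cvgM.
  apply: (@continuous_comp _ _ _ p (fun x => x ^+ k)); first exact: cp.
  exact: exprn_continuous.
apply: (@continuous_comp _ _ _ (fun u => - t * p u) expR); last exact: continuous_expR.
by apply: cvgM; [exact: cvg_cst|exact: cp].
Qed.

Definition sinh (u : R) : R := (expR u - expR (- u)) / 2.

Lemma sinh0 : sinh 0 = 0. Proof. by rewrite /sinh oppr0 subrr mul0r. Qed.

Lemma cosh2E (u : R) : cosh u ^+ 2 = sinh u ^+ 2 + 1.
Proof. by have := expRxMexpNx_1 u; rewrite /cosh /sinh => h; field: h. Qed.

Lemma cosh_ge1 (u : R) : 1 <= cosh u.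
Proof.
by have := expR_ge1Dx u; have := expR_ge1Dx (- u); rewrite /cosh; lra.
Qed.

Lemma sinh_ge_cosh (u : R) : 0 <= u -> cosh u - 1 <= sinh u.
Proof.
move=> u0; have : expR (- u) <= 1 by rewrite -expR0 ler_expR; lra.
by rewrite /cosh /sinh; lra.
Qed.

Lemma sinh_le_cosh (u : R) : sinh u <= cosh u.
Proof. by have := expR_ge0 (- u); rewrite /cosh /sinh; lra. Qed.

Lemma sinh_ge0 (u : R) : 0 <= u -> 0 <= sinh u.
Proof.
move=> u0; have : expR (- u) <= expR u by rewrite ler_expR; lra.
by rewrite /sinh; lra.
Qed.

Lemma is_derive_expRN (u : R) : is_derive u 1 (fun u => expR (- u)) (- expR (- u)).
Proof. by have := is_derive_expcomp (is_deriveNid u 1); rewrite mulrN1. Qed.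

Lemma is_derive_cosh (u : R) : is_derive u 1 (@cosh R) (sinh u).
Proof.
have h := is_derive_mul (is_deriveD (is_derive_expR u) (is_derive_expRN u))
  (is_derive_cst (2^-1 : R) u 1).
by apply: (is_derive_eq h); rewrite mulr0 addr0 /sinh /cst.
Qed.

Lemma is_derive_sinh (u : R) : is_derive u 1 sinh (cosh u).
Proof.
have h := is_derive_mul (is_deriveB (is_derive_expR u) (is_derive_expRN u))
  (is_derive_cst (2^-1 : R) u 1).
by apply: (is_derive_eq h); rewrite mulr0 addr0 /cosh /cst opprK.
Qed.

(** One term of the exponential series: (tx)^k / k! <= e^{tx}. *)
Lemma powM_expRN_le k (t x : R) : 0 < t -> 0 <= x ->
  x ^+ k * expR (- t * x) <= k`!%:R / t ^+ k.
Proof.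
move=> t0 x0; have tx0 : 0 <= t * x by rewrite mulr_ge0// ltW.
have tk0 : 0 < t ^+ k by rewrite exprn_gt0.
have k0 : 0 < k`!%:R :> R by rewrite ltr0n fact_gt0.
have h : (t * x) ^+ k / k`!%:R <= expR (t * x).
  case: k {tk0 k0} => [|k]; last first.
    by have := expR_ge1Dxn k tx0; lra.
  by rewrite expr0 fact0 divr1; have := expR_ge1Dx (t * x); lra.
rewrite ler_pdivlMr// mulNr expRN mulrAC -exprMn [x * t]mulrC.
by rewrite ler_pdivrMr ?expR_gt0// [leRHS]mulrC -ler_pdivrMr.
Qed.

(** One power of cosh u is traded for the integrable factor
    1 / cosh u <= 2 e^{-u}. *)
Lemma le_coshX_expRN k (t u : R) : 0 < t ->
  cosh u ^+ k * expR (- t * cosh u) <= 2 * (k.+1`!%:R / t ^+ k.+1) * expR (- u).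
Proof.
move=> t0; have c1 := cosh_ge1 u; have c0 : 0 < cosh u by lra.
have := powM_expRN_le k.+1 t0 (ltW c0).
set B := _ / _ => h.
have B0 : 0 <= B.
  by rewrite divr_ge0// exprn_ge0// ltW.
have {}h : cosh u ^+ k * expR (- t * cosh u) <= B * (cosh u)^-1.
  by rewrite ler_pdivlMr// mulrAC -exprSr.
apply: (le_trans h); rewrite [2 * B]mulrC -[leRHS]mulrA ler_wpM2l//.
rewrite -[leLHS]mul1r ler_pdivrMr//.
have := expRxMexpNx_1 u; have := expR_gt0 (- u); rewrite /cosh; nra.
Qed.

Lemma integrable_coshX k (t : R) : 0 < t ->
  mu.-integrable `[0, +oo[ (EFin \o (fun u => cosh u ^+ k * expR (- t * cosh u))).
Proof.
move=> t0; apply: (@le_expRN_integrable _ _ _ (2 * (k.+1`!%:R / t ^+ k.+1)) 1) => //.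
  by apply: measurable_funTS; apply: continuous_measurable_fun;
     apply: continuous_kernel; exact: continuous_cosh.
move=> u _; have c1 := cosh_ge1 u.
rewrite ger0_norm; last by rewrite mulr_ge0 ?expR_ge0// exprn_ge0//; lra.
by rewrite mulN1r; exact: le_coshX_expRN.
Qed.

Lemma bessel_pair_lapK : bessel_pair (lapK 0) (fun t => - t * lapK 1 t).
Proof.
apply: laplace_bessel_pair => //.
- by move=> u; have := cosh_ge1 u; lra.
- by move=> k t; exact: integrable_coshX.
move=> t t0.
pose F u := sinh u * expR (- t * cosh u).
have dF (u : R) : is_derive u 1 F
   ((cosh u - t * (cosh u ^+ 2 - 1)) * expR (- t * cosh u)).
  have h := is_derive_mul (is_derive_sinh u)
    (is_derive_expcomp (is_derive_mul (is_derive_cst (- t) u 1) (is_derive_cosh u))).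
  by apply: (is_derive_eq h); rewrite cosh2E /cst; ring.
have intF : mu.-integrable `[0, +oo[ (EFin \o (fun u =>
    (cosh u - t * (cosh u ^+ 2 - 1)) * expR (- t * cosh u))).
  rewrite (_ : (fun _ => _) = (fun u => cosh u ^+ 1 * expR (- t * cosh u) +
    (- t * (cosh u ^+ 2 * expR (- t * cosh u)) +
     t * (cosh u ^+ 0 * expR (- t * cosh u))))); last first.
    by apply/funext => u; ring.
  apply: integrable_realD => //; first exact: integrable_coshX.
  by apply: integrable_realD => //; apply: integrable_realZ => //;
    exact: integrable_coshX.
have sub0y : `]0, +oo[ `<=` `[0 : R, +oo[.
  by move=> u; rewrite /= !in_itv/= !andbT; exact: ltW.
rewrite -Rintegral_itv_obnd_cbnd; last first.
  by apply: integrableS intF => //; exact: sub0y.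
rewrite (@FTC_itv0y _ _ F 0 0) ?subrr//.
- move=> u _; have dcosh := is_derive_cosh u.
  have dcosh2 := is_derive_mul dcosh dcosh.
  have dE := is_derive_expcomp (is_derive_mul (is_derive_cst (- t) u 1) dcosh).
  have h := is_derive_mul (is_deriveB dcosh (is_derive_mul (is_derive_cst t u 1)
    (is_deriveB dcosh2 (is_derive_cst (1 : R) u 1)))) dE.
  exact: (is_derive_continuous h).
- by apply: integrableS intF => //; exact: sub0y.
- rewrite -[X in _ --> X](_ : F 0 = 0); last by rewrite /F sinh0 mul0r.
  apply: cvg_at_right_filter; exact: (is_derive_continuous (dF 0)).
- apply: (@le_expRN_cvgy _ _ (2 * (2`!%:R / t ^+ 2)) 1) => // u u1.
  have u0 : 0 < u by lra.
  have s0 := sinh_ge0 (ltW u0); rewrite ger0_norm; last exact: mulr_ge0 s0 (expR_ge0 _).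
  apply: le_trans (_ : cosh u ^+ 1 * expR (- t * cosh u) <= _).
    by rewrite ler_wpM2r ?expR_ge0// sinh_le_cosh.
  by rewrite mulN1r; exact: le_coshX_expRN.
Qed.

(** If the exponent - t cosh u is replaced by - t sinh u, the integral of
    t cosh u e^{- t sinh u} is exactly 1.  On u >= 0 one has
    sinh u <= cosh u <= sinh u + 1, so the replacement changes the integrand
    by a factor between 1 and e^t.  These bounds give both the boundedness of
    theta K_0 and its limit -1 at 0. *)
Lemma lapK1_bounds (t : R) : 0 < t -> expR (- t) <= t * lapK 1 t <= 1.
Proof.
move=> t0.
pose f (u : R) := cosh u * expR (- t * sinh u).
pose F (u : R) := - t^-1 * expR (- t * sinh u).
have dE (u : R) := is_derive_expcomp
  (is_derive_mul (is_derive_cst (- t) u 1) (is_derive_sinh u)).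
have dF (u : R) : is_derive u 1 F (f u).
  have h := is_derive_mul (is_derive_cst (- t^-1) u 1) (dE u).
  by apply: (is_derive_eq h); rewrite /f /cst; field; lra.
have cf (u : R) : {for u, continuous f}.
  exact: (is_derive_continuous (is_derive_mul (is_derive_cosh u) (dE u))).
have f0 u : 0 <= f u.
  by rewrite mulr_ge0 ?expR_ge0//; have := cosh_ge1 u; lra.
have fle u : 0 <= u -> f u <= expR t * (cosh u ^+ 1 * expR (- t * cosh u)).
  move=> u0; rewrite mulrCA -expRD ler_wpM2l//; first by have := cosh_ge1 u; lra.
  by rewrite ler_expR; have := sinh_ge_cosh u0; nra.
have intK : mu.-integrable `[0, +oo[
    (EFin \o (fun u => cosh u ^+ 1 * expR (- t * cosh u))).
  exact: integrable_coshX.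
have mf : measurable_fun (`[0, +oo[ : set R) f.
  by apply: measurable_funTS; apply: continuous_measurable_fun.
have intf : mu.-integrable `[0, +oo[ (EFin \o f).
  have intK' := integrable_realZ (expR t) (measurable_itv _) intK.
  apply: (@le_integrable _ _ _ mu _ _ _ _ _ _ intK') => //.
    exact/measurable_EFinP.
  move=> u; rewrite /= in_itv/= andbT => u0.
  by rewrite lee_fin ger0_norm// (le_trans (fle u u0))// ler_norm.
have If : \int[mu]_(u in `[0, +oo[) f u = t^-1.
  rewrite (@Rintegral_ge0_continuous_FTC2y _ _ F 0 0).
  - by rewrite /F sinh0 mulr0 expR0; ring.
  - by [].
  - exact: continuous_subspaceT.
  - rewrite -[X in _ --> X](mulr0 (- t^-1)).
    apply: cvgM; first exact: cvg_cst.
    apply: (@le_expRN_cvgy _ _ (expR t) (t / 2)); first lra.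
    move=> u u1; have u0 : 0 < u by lra.
    rewrite ger0_norm ?expR_ge0// -expRD ler_expR.
    have := sinh_ge_cosh (ltW u0).
    have := expR_ge1Dx u; have := expR_ge0 (- u); rewrite /cosh; nra.
  - by move=> u _; case: (dF u).
  - by apply: cvg_at_right_filter; exact: (is_derive_continuous (dF 0)).
  - by move=> u _; rewrite derive1E; case: (dF u).
apply/andP; split.
  rewrite -ler_pdivrMl// mulrC -If -RintegralZl//.
  apply: le_Rintegral => //; first exact: integrable_realZ.
  move=> u; rewrite /= in_itv/= andbT => u0.
  rewrite -ler_pdivlMl ?expR_gt0// -expRN opprK.
  exact: fle.
rewrite -ler_pdivlMl// mulr1 -If; apply: le_Rintegral => //.
move=> u; rewrite /= in_itv/= andbT => u0.
rewrite expr1 /f ler_wpM2l//; first by have := cosh_ge1 u; lra.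
by rewrite ler_expR; have := sinh_le_cosh u; nra.
Qed.

Lemma lapK_ge0 k t : 0 <= lapK k t.
Proof.
apply: Rintegral_ge0 => u _; rewrite mulr_ge0 ?expR_ge0// exprn_ge0//.
by have := cosh_ge1 u; lra.
Qed.

(** As cosh u >= 1, one has e^{-t cosh u} <= e^{-(t-1)} e^{-cosh u}. *)
Lemma lapK_le_expRN k (t : R) : 1 <= t -> lapK k t <= expR (1 - t) * lapK k 1.
Proof.
move=> t1; rewrite /laplace -RintegralZl//; last exact: integrable_coshX.
apply: le_Rintegral => //; first by apply: integrable_coshX; lra.
  by apply: integrable_realZ => //; exact: integrable_coshX.
move=> u _; have c1 := cosh_ge1 u.
rewrite [leRHS]mulrCA -expRD ler_wpM2l//; first by rewrite exprn_ge0//; lra.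
by rewrite ler_expR; nra.
Qed.

(** As |theta K_0| <= 1, the function K_0 + ln is nondecreasing. *)
Lemma lapK0_le_ln (t : R) : 0 < t -> t <= 1 -> lapK 0 t <= lapK 0 1 - ln t.
Proof.
move=> t0 t1.
have dF (x : R) : 0 < x ->
    is_derive x 1 (fun x => lapK 0 x + ln x) ((1 - x * lapK 1 x) / x).
  move=> x0; have [h _] := bessel_pair_lapK x0.
  apply: (is_derive_eq (is_deriveD h (is_derive1_ln x0))); field; lra.
have [||c] := @MVT_segment _ (fun x => lapK 0 x + ln x)
  (fun x => (1 - x * lapK 1 x) / x) t 1 t1.
- by move=> x; rewrite in_itv/= => /andP[x0 _]; apply: dF; lra.
- apply: continuous_in_subspaceT => x /set_mem/=; rewrite in_itv/= => /andP[x0 _].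
  by apply: is_derive_continuous (dF x _); lra.
rewrite in_itv/= => /andP[ct _]; rewrite ln1 addr0 => h.
have c0 : 0 < c := lt_le_trans t0 ct.
have /andP[_ c1] := lapK1_bounds c0.
have : 0 <= (1 - c * lapK 1 c) / c * (1 - t).
  apply: mulr_ge0; last by rewrite subr_ge0.
  by apply: divr_ge0; [rewrite subr_ge0|exact: ltW].
by rewrite -h subr_ge0 lerBrDr.
Qed.

Lemma integrable_cosX k (t : R) : mu.-integrable `[0, pi]
  (EFin \o (fun u => (- cos u) ^+ k * expR (- t * - cos u))).
Proof.
apply: continuous_compact_integrable; first exact: segment_compact.
apply: continuous_subspaceT; apply: (@continuous_kernel (fun u => - cos u)).
by move=> u; apply: cvgN; exact: continuous_cos.
Qed.

Lemma bessel_pair_lapI : bessel_pair (lapI 0) (fun t => - t * lapI 1 t).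
Proof.
apply: laplace_bessel_pair => //.
- by move=> u; have := cos_le1 u; lra.
- by move=> k t _; exact: integrable_cosX.
move=> t t0.
pose F u := - sin u * expR (- t * - cos u).
have dncos (u : R) : is_derive u 1 (fun u => - cos u) (sin u).
  by apply: (is_derive_eq (is_deriveN (is_derive_cos u))); rewrite opprK.
have dE (u : R) := is_derive_expcomp
  (is_derive_mul (is_derive_cst (- t) u 1) (dncos u)).
have dF (u : R) : is_derive u 1 F
   ((- cos u - t * ((- cos u) ^+ 2 - 1)) * expR (- t * - cos u)).
  have dnsin : is_derive u 1 (fun u => - sin u) (- cos u).
    exact: (is_deriveN (is_derive_sin u)).
  have h := is_derive_mul dnsin (dE u).
  apply: (is_derive_eq h); have := sin2cos2 u; rewrite /cst => s2.
  by ring: s2.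
rewrite /Rintegral (@continuous_FTC2 _ _ F) ?pi_gt0//.
- by rewrite /F sin0 sinpi !oppr0 !mul0r -EFinB subrr.
- apply: continuous_subspaceT => u.
  have dcos2 := is_derive_mul (dncos u) (dncos u).
  have h := is_derive_mul (is_deriveB (dncos u) (is_derive_mul (is_derive_cst t u 1)
    (is_deriveB dcos2 (is_derive_cst (1 : R) u 1)))) (dE u).
  exact: (is_derive_continuous h).
- split; first by move=> u _; case: (dF u).
  + by apply: cvg_at_right_filter; exact: (is_derive_continuous (dF _)).
  + by apply: cvg_at_left_filter; exact: (is_derive_continuous (dF _)).
- by move=> u _; rewrite derive1E; case: (dF u).
Qed.

Lemma norm_lapI_le k (t : R) : 0 <= t -> `|lapI k t| <= pi * expR t.
Proof.
move=> t0; have pi0 : 0 < pi :> R := pi_gt0 R.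
apply: (le_trans (le_normr_Rintegral _ (integrable_cosX k t))) => //.
have -> : pi * expR t = \int[mu]_(u in `[0, pi]) (expR t : R).
  rewrite Rintegral_cst//= lebesgue_measure_itv/= lte_fin pi0 oppr0 adde0/=.
  by rewrite mulrC.
apply: le_Rintegral => //.
- exact/integrable_norm/integrable_cosX.
- apply: continuous_compact_integrable; first exact: segment_compact.
  by apply: continuous_subspaceT => x; exact: cvg_cst.
move=> u _; rewrite normrM normrX normrN (ger0_norm (expR_ge0 _)).
rewrite -[leRHS]mul1r ler_pM ?exprn_ge0 ?expR_ge0//.
  by rewrite exprn_ile1// cos_max.
by rewrite ler_expR; have := cos_le1 u; nra.
Qed.

(** theta I_0 = t I_1, in terms of the modified Bessel function I_1. *)
Definition thetaI (t : R) : R := pi^-1 * (- t * lapI 1 t).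

(** theta K_0 = - t K_1, in terms of the modified Bessel function K_1. *)
Definition thetaK (t : R) : R := - t * lapK 1 t.

Lemma besselI0E : @besselI0 R = fun t => pi^-1 * lapI 0 t.
Proof.
apply/funext => t; congr (_ * _); apply: eq_Rintegral => u _.
by rewrite expr0 mul1r mulrNN.
Qed.

Lemma besselK0E : @besselK0 R = lapK 0.
Proof. by apply/funext => t; apply: eq_Rintegral => u _; rewrite expr0 mul1r. Qed.

Lemma bessel_pair_I : bessel_pair (@besselI0 R) thetaI.
Proof. by rewrite besselI0E; apply: bessel_pairZ bessel_pair_lapI. Qed.

Lemma bessel_pair_K : bessel_pair (@besselK0 R) thetaK.
Proof. by rewrite besselK0E; exact: bessel_pair_lapK. Qed.

Lemma norm_besselI0_le (t : R) : 0 < t -> `|besselI0 t| <= (1 + t) * expR t.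
Proof.
move=> t0; have pi0 : 0 < pi :> R := pi_gt0 R.
have := norm_lapI_le 0 (ltW t0); rewrite besselI0E normrM gtr0_norm ?invr_gt0//.
rewrite ler_pdivrMl// => h; apply: (le_trans h).
by rewrite (ler_wpM2l (ltW pi0))// ler_peMl ?expR_ge0//; lra.
Qed.

Lemma norm_thetaI_le (t : R) : 0 < t -> `|thetaI t| <= t * expR t.
Proof.
move=> t0; have pi0 : 0 < pi :> R := pi_gt0 R.
have h := norm_lapI_le 1 (ltW t0).
rewrite /thetaI normrM gtr0_norm ?invr_gt0// normrM normrN (gtr0_norm t0).
by rewrite ler_pdivrMl// mulrCA ler_wpM2l// ltW.
Qed.

Lemma norm_besselK0_le1 (t : R) : 0 < t -> t <= 1 ->
  `|besselK0 t| <= (1 + besselK0 1) - ln t.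
Proof.
move=> t0 t1; rewrite besselK0E ger0_norm ?lapK_ge0//.
by rewrite (le_trans (lapK0_le_ln t0 t1))// -addrA lerDr.
Qed.

Lemma norm_thetaK_le1 (t : R) : 0 < t -> `|thetaK t| <= 1.
Proof.
move=> t0; have /andP[_ h] := lapK1_bounds t0.
by rewrite /thetaK mulNr normrN ger0_norm// mulr_ge0 ?lapK_ge0// ltW.
Qed.

Lemma cvg_thetaK : thetaK t @[t --> 0^'+] --> (-1 : R).
Proof.
have -> : thetaK = (fun t => - (t * lapK 1 t)).
  by apply/funext => t; rewrite /thetaK mulNr.
apply: cvgN; apply: (@squeeze_cvgr _ _ _ _ (fun t => expR (- t)) (cst 1)).
- by near=> t; apply: lapK1_bounds; near: t; exact: nbhs_right_gt.
- rewrite -[X in _ --> X]expR0 -[X in expR X]oppr0; apply: cvg_at_right_filter.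
  exact: (is_derive_continuous (is_derive_expRN 0)).
- exact: cvg_cst.
Unshelve. all: by end_near. Qed.

Lemma cvg_thetaI : thetaI t @[t --> 0^'+] --> (0 : R).
Proof.
apply: norm_cvg0; apply: (@squeeze_cvgr _ _ _ _ (cst 0) (fun t => t * expR t)).
- near=> t; rewrite normr_ge0/=; apply: norm_thetaI_le.
  by near: t; exact: nbhs_right_gt.
- exact: cvg_cst.
- rewrite -[X in _ --> X](mul0r (expR 0)); apply: cvg_at_right_filter.
  by apply: cvgM; [exact: cvg_id|exact: continuous_expR].
Unshelve. all: by end_near. Qed.

Lemma norm_K_le_large : exists2 C : R, 0 <= C & forall t : R, 1 <= t ->
  `|besselK0 t| <= C * ((1 + t) * expR (- t)) /\
  `|thetaK t| <= C * ((1 + t) * expR (- t)).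
Proof.
exists (expR 1 * (lapK 0 1 + lapK 1 1)).
  by rewrite mulr_ge0 ?expR_ge0// addr_ge0// lapK_ge0.
move=> t t1; rewrite besselK0E /thetaK mulNr normrN.
have h0 := lapK_ge0 0 1; have h1 := lapK_ge0 1 1.
have e0 : 0 <= expR 1 * expR (- t) :> R by rewrite mulr_ge0 ?expR_ge0.
have hexp k : lapK k t <= expR 1 * expR (- t) * lapK k 1.
  by rewrite -expRD; exact: lapK_le_expRN.
have C0 : lapK 0 1 <= (lapK 0 1 + lapK 1 1) * (1 + t) by nra.
have C1 : t * lapK 1 1 <= (lapK 0 1 + lapK 1 1) * (1 + t) by nra.
have -> : expR 1 * (lapK 0 1 + lapK 1 1) * ((1 + t) * expR (- t)) =
  expR 1 * expR (- t) * ((lapK 0 1 + lapK 1 1) * (1 + t)) by ring.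
split.
  by rewrite ger0_norm ?lapK_ge0// (le_trans (hexp 0))// ler_wpM2l.
have t0 : 0 <= t by lra.
rewrite ger0_norm; last exact: mulr_ge0 t0 (lapK_ge0 _ _).
apply: (le_trans (ler_wpM2l t0 (hexp 1))).
by rewrite mulrCA ler_wpM2l.
Qed.

End Bessel.

(** * Products of solutions of the Bessel equation *)

Section SymmetricProduct.
Context {R : realType}.

(** A product P of n linear polynomials f + (theta f) X, where each f solves
    theta^2 f = t^2 f, satisfies
      theta P = (1 - t^2 X^2) P' + n t^2 X P,
    where P' is the derivative in X.  This is the right-hand side: a derivation
    plus a multiplication proportional to n, whence the product rule of
    [bessel_familyM]. *)
Definition besselop (n : nat) (t : R) (p : {poly R}) : {poly R} :=
  p^`() + t ^+ 2 *: ('X * (n%:R *: p - 'X * p^`())).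

Lemma coef_besselop n t p j :
  (besselop n t p)`_j = j.+1%:R * p`_j.+1 +
    t ^+ 2 * (if j is i.+1 then (n%:R - i%:R) * p`_i else 0).
Proof.
rewrite /besselop coefD coef_deriv coefZ coefXM mulr_natl; congr (_ + _ * _).
case: j => //= j; rewrite coefB coefZ coefXM.
case: j => [|j] /=; first by rewrite subr0 subr0.
by rewrite coef_deriv -mulr_natr; ring.
Qed.

Definition bessel_family (n : nat) (P : R -> {poly R}) := forall t : R, 0 < t ->
  forall j, is_derive t 1 (fun s => (P s)`_j) (t^-1 * (besselop n t (P t))`_j).

Lemma bessel_family_pair (f phi : R -> R) : bessel_pair f phi ->
  bessel_family 1 (fun t => (f t)%:P + phi t *: 'X).
Proof.
move=> fphi t t0; have [df dphi] := fphi t t0.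
have coefE s j : ((f s)%:P + phi s *: 'X)`_j =
    if j is 0%N then f s else if j is 1%N then phi s else 0.
  rewrite coefD coefC coefZ coefX.
  by case: j => [|[|j]] /=; rewrite ?mulr0 ?addr0 ?add0r ?mulr1.
move=> j; under eq_fun do rewrite coefE; rewrite coef_besselop coefE.
case: j => [|[|[|j]]] /=; rewrite ?coefE.
- by apply: (is_derive_eq df); field; rewrite gt_eqF.
- by apply: (is_derive_eq dphi); field; rewrite gt_eqF.
- apply: (is_derive_eq (is_derive_cst (0 : R) t 1)); ring.
- apply: (is_derive_eq (is_derive_cst (0 : R) t 1)); ring.
Qed.

Lemma bessel_familyM m n (P Q : R -> {poly R}) :
  bessel_family m P -> bessel_family n Q ->
  bessel_family (m + n) (fun t => P t * Q t).
Proof.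
move=> hP hQ t t0 j.
have -> : besselop (m + n) t (P t * Q t) =
    besselop m t (P t) * Q t + P t * besselop n t (Q t).
  rewrite /besselop derivM natrD -!mul_polyC polyCD; ring.
have h (i : 'I_j.+1) := is_derive_mul (hP t t0 i) (hQ t t0 (j - i)%N).
have := is_derive_sum h.
rewrite (_ : \sum_i _ = (fun s => (P s * Q s)`_j)); last first.
  by apply/funext => s; rewrite coefM fct_sumE.
move/is_derive_eq; apply.
rewrite coefD !coefM mulrDr !mulr_sumr -big_split/=.
by apply: eq_bigr => i _; ring.
Qed.

Lemma bessel_familyX n (P : R -> {poly R}) :
  bessel_family 1 P -> bessel_family n (fun t => P t ^+ n).
Proof.
move=> hP; elim: n => [|n IH].
  move=> t t0 j; under eq_fun do rewrite expr0.
  apply: (is_derive_eq (is_derive_cst _ t 1)).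
  rewrite expr0 coef_besselop coef1.
  by case: j => [|[|j]] /=; rewrite ?coef1 /=; ring.
have := bessel_familyM hP IH; rewrite add1n.
by under eq_fun do rewrite -exprS.
Qed.

(** The bound J on the index keeps the factor J + 1 the same for all the
    coefficients, so that the estimate can be iterated. *)
Lemma norm_coefM_le (J : nat) (p q : {poly R}) (A B : R) :
  (forall j, (j <= J)%N -> `|p`_j| <= A) ->
  (forall j, (j <= J)%N -> `|q`_j| <= B) ->
  forall j, (j <= J)%N -> `|(p * q)`_j| <= J.+1%:R * (A * B).
Proof.
move=> hp hq j jJ; rewrite coefM (le_trans (ler_norm_sum _ _ _))//.
have AB0 : 0 <= A * B.
  by rewrite mulr_ge0//; [apply: le_trans (hp 0%N _)|apply: le_trans (hq 0%N _)].
apply: (@le_trans _ _ (\sum_(i < j.+1) A * B)).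
  apply: ler_sum => i _; rewrite normrM ler_pM//.
    by apply/hp/(leq_trans _ jJ); rewrite -ltnS.
  by apply/hq/(leq_trans (leq_subr _ _)).
by rewrite sumr_const card_ord -[leLHS]mulr_natl ler_wpM2r// ler_nat ltnS.
Qed.

Lemma norm_coefX_le (J n : nat) (p : {poly R}) (A : R) :
  (forall j, (j <= J)%N -> `|p`_j| <= A) ->
  forall j, (j <= J)%N -> `|(p ^+ n)`_j| <= (J.+1%:R * A) ^+ n.
Proof.
move=> hp; elim: n => [|n IH] j jJ.
  by rewrite !expr0 coefC; case: eqP; rewrite ?normr1 ?normr0.
rewrite !exprS -mulrA; exact: norm_coefM_le.
Qed.

Lemma coefM_top m n (p q : {poly R}) : (size p <= m.+1)%N -> (size q <= n.+1)%N ->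
  (p * q)`_(m + n) = p`_m * q`_n.
Proof.
move=> sp sq; have hm : (m < (m + n).+1)%N by rewrite ltnS leq_addr.
rewrite coefM (bigD1 (Ordinal hm))//= addKn big1 ?addr0// => i.
rewrite -val_eqE/= => im.
have [mi|im'] := ltnP m i.
  by rewrite nth_default ?mul0r// (leq_trans sp).
have {}im : (i < m)%N by rewrite ltn_neqAle im.
rewrite [q`__]nth_default ?mulr0// (leq_trans sq)//.
by rewrite ltn_subRL ltn_add2r.
Qed.

Lemma size_linX (f phi : R) n : (size ((f%:P + phi *: 'X) ^+ n) <= n.+1)%N.
Proof.
have s2 : (size (f%:P + phi *: 'X)%R <= 2)%N.
  rewrite (leq_trans (size_polyD _ _))// geq_max (leq_trans (size_polyC_leq1 _))//=.
  by rewrite (leq_trans (size_scale_leq _ _))// size_polyX.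
rewrite (leq_trans (size_poly_exp_leq _ _))// ltnS.
by case: (size _) s2 => [|[|[|]]]//= _; rewrite ?mul0n ?mul1n.
Qed.

Lemma coef_top_linX (f phi : R) n : ((f%:P + phi *: 'X) ^+ n)`_n = phi ^+ n.
Proof.
elim: n => [|n IH]; first by rewrite !expr0 coefC.
have := size_linX f phi 1; rewrite expr1 => s1.
rewrite exprS -add1n (coefM_top s1 (size_linX _ _ _)) IH exprS.
by rewrite coefD coefC coefZ coefX/= mulr1 add0r.
Qed.

End SymmetricProduct.

(** * Moments of the coefficients of the product *)

Section Moments.
Context {R : realType}.
Local Notation mu := (@lebesgue_measure R).
Variables (a b : nat).
Hypothesis ab : (a < b)%N.
Local Notation n := (a + b)%N.

Definition besselprod (t : R) : {poly R} :=
  ((besselI0 t)%:P + thetaI t *: 'X) ^+ a * ((besselK0 t)%:P + thetaK t *: 'X) ^+ b.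

Definition bcoef (j : nat) (t : R) : R := (besselprod t)`_j.

Lemma bcoef0 t : bcoef 0 t = besselI0 t ^+ a * besselK0 t ^+ b.
Proof.
rewrite /bcoef coef0M -!horner_coef0 !horner_exp.
by rewrite !hornerD !hornerC !hornerZ !hornerX !mulr0 !addr0.
Qed.

Lemma bcoef_top t : bcoef n t = thetaI t ^+ a * thetaK t ^+ b.
Proof. by rewrite /bcoef coefM_top ?size_linX// !coef_top_linX. Qed.

Lemma bcoef_gt t j : (n < j)%N -> bcoef j t = 0.
Proof.
move=> nj; rewrite /bcoef nth_default// (leq_trans _ nj)//.
rewrite (leq_trans (size_polyMleq _ _))//.
rewrite -ltnS; case: (size _) (size_linX (besselI0 t) (thetaI t) a) => [|k] sa.
  by have := size_linX (besselK0 t) (thetaK t) b; lia.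
by have := size_linX (besselK0 t) (thetaK t) b; lia.
Qed.

Definition bcoef_prev (j : nat) (t : R) : R :=
  if j is i.+1 then (n%:R - i%:R) * bcoef i t else 0.

Lemma is_derive_bcoef j (t : R) : 0 < t -> is_derive t 1 (bcoef j)
  (t^-1 * (j.+1%:R * bcoef j.+1 t + t ^+ 2 * bcoef_prev j t)).
Proof.
move=> t0; have hI := bessel_familyX a (bessel_family_pair (@bessel_pair_I R)).
have hK := bessel_familyX b (bessel_family_pair (@bessel_pair_K R)).
have := bessel_familyM hI hK t0 j; rewrite coef_besselop /bcoef_prev.
by case: j.
Qed.

Lemma norm_bcoef_le j (t A B : R) :
  `|besselI0 t| <= A -> `|thetaI t| <= A -> `|besselK0 t| <= B -> `|thetaK t| <= B ->
  `|bcoef j t| <= j.+1%:R * (j.+1%:R ^+ n * (A ^+ a * B ^+ b)).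
Proof.
move=> hI1 hI2 hK1 hK2.
have lin (f phi C : R) : `|f| <= C -> `|phi| <= C ->
    forall i, (i <= j)%N -> `|(f%:P + phi *: 'X)`_i| <= C.
  move=> h1 h2 i _; rewrite coefD coefC coefZ coefX.
  case: i => [|[|i]] /=; rewrite ?mulr0 ?mulr1 ?addr0 ?add0r//.
  by rewrite normr0 (le_trans _ h1).
have -> : j.+1%:R ^+ n * (A ^+ a * B ^+ b) = (j.+1%:R * A) ^+ a * (j.+1%:R * B) ^+ b.
  by rewrite !exprMn exprD; ring.
by apply: (@norm_coefM_le _ j) => // i ij; apply: (@norm_coefX_le _ j) => //;
  exact: lin.
Qed.

(** Each factor I_0 contributes e^t and each factor K_0 contributes e^{-t}, up
    to powers of 1 + t; since a < b at least one e^{-t} is left, and half of it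
    absorbs all the powers. *)
Lemma bcoef_bound_large m j : exists2 C : R, 0 <= C & forall t : R, 1 <= t ->
  `|t ^+ m * bcoef j t| <= C * expR (- (1 / 2) * t).
Proof.
have [C C0 hC] := @norm_K_le_large R.
pose D : R := j.+1%:R * (j.+1%:R ^+ n * C ^+ b).
have D0 : 0 <= D by rewrite !mulr_ge0 ?exprn_ge0.
pose N := (m + n)%N.
exists (D * (N`!%:R / (1 / 2) ^+ N * expR (1 / 2))).
  by rewrite mulr_ge0// mulr_ge0 ?expR_ge0// divr_ge0// exprn_ge0//; lra.
move=> t t1; have t0 : 0 < t by lra.
have e0 := expR_gt0 t.
have hI1 := norm_besselI0_le t0.
have hI2 : `|thetaI t| <= (1 + t) * expR t.
  by apply: (le_trans (norm_thetaI_le t0)); nra.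
have [hK1 hK2] := hC t t1.
have := norm_bcoef_le j hI1 hI2 hK1 hK2.
set E := _ * (_ * (_ * _)) => hE.
have {}hE : `|bcoef j t| <= D * ((1 + t) ^+ n * expR (- t)).
  apply: (le_trans hE).
  have -> : E = D * ((1 + t) ^+ n * (expR t ^+ a * expR (- t) ^+ b)).
    by rewrite /E /D !exprD !exprMn; ring.
  rewrite ler_wpM2l// ler_wpM2l ?exprn_ge0//; first by lra.
  rewrite -!expRM_natl -expRD ler_expR.
  have : a%:R + 1 <= b%:R :> R by rewrite natr1 ler_nat.
  nra.
rewrite normrM normrX (gtr0_norm t0).
have tm : t ^+ m <= (1 + t) ^+ m by rewrite lerXn2r ?nnegrE//; lra.
apply: (le_trans (ler_pM _ _ tm hE)); rewrite ?exprn_ge0//; first lra.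
have -> : (1 + t) ^+ m * (D * ((1 + t) ^+ n * expR (- t))) =
    D * ((1 + t) ^+ N * expR (- t)) by rewrite /N [X in _ = D * (X * _)]exprD; ring.
rewrite -mulrA ler_wpM2l//.
have -> : expR (- t) =
    expR (- (1 / 2) * (1 + t)) * (expR (1 / 2) * expR (- (1 / 2) * t)).
  by rewrite -!expRD; congr expR; field.
rewrite !mulrA -[leRHS]mulrA -[leLHS]mulrA ler_wpM2r ?mulr_ge0 ?expR_ge0//.
by apply: powM_expRN_le; lra.
Qed.

(** Near 0 the only unbounded factor is K_0, which grows like - ln t, and one
    power of t absorbs every power of the logarithm. *)
Lemma bcoef_bound_small j : exists2 C : R, 0 <= C & forall t : R, 0 < t -> t <= 1 ->
  `|t * bcoef j t| <= C.
Proof.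
pose L : R := 1 + besselK0 1.
pose D : R := j.+1%:R * (j.+1%:R ^+ n * (2 * expR 1) ^+ a).
have D0 : 0 <= D by rewrite !mulr_ge0 ?exprn_ge0// mulr_ge0// expR_ge0.
exists (D * (expR L * b`!%:R)).
  by rewrite !mulr_ge0// expR_ge0.
move=> t t0 t1.
have L1 : 1 <= L.
  by rewrite /L lerDl besselK0E lapK_ge0.
have ln0 : ln t <= 0 by rewrite ln_le0.
have e1 : expR t <= expR 1 by rewrite ler_expR.
have e0 := expR_gt0 t.
have hI1 : `|besselI0 t| <= 2 * expR 1.
  by apply: (le_trans (norm_besselI0_le t0)); nra.
have hI2 : `|thetaI t| <= 2 * expR 1.
  by apply: (le_trans (norm_thetaI_le t0)); nra.
have hK2 : `|thetaK t| <= L - ln t.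
  by apply: (le_trans (norm_thetaK_le1 t0)); lra.
have := norm_bcoef_le j hI1 hI2 (norm_besselK0_le1 t0 t1) hK2.
rewrite -/L => hE; rewrite normrM gtr0_norm//.
apply: (le_trans (ler_wpM2l (ltW t0) hE)).
have -> : t * (j.+1%:R * (j.+1%:R ^+ n * ((2 * expR 1) ^+ a * (L - ln t) ^+ b))) =
  D * ((L - ln t) ^+ b * t) by rewrite /D; ring.
rewrite ler_wpM2l//.
have w0 : 0 <= L - ln t by lra.
(* with w = L - ln t, the product w^b t is e^L w^b e^{-w} *)
have tE : t = expR L * expR (- 1 * (L - ln t)).
  by rewrite -expRD -[LHS]lnK ?posrE//; congr expR; ring.
rewrite [X in _ * X <= _]tE mulrCA ler_wpM2l ?expR_ge0//.
by have := powM_expRN_le b ltr01 w0; rewrite expr1n divr1.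
Qed.

Lemma bcoef_bound m j : exists2 C : R, 0 <= C & forall t : R, 0 < t ->
  `|t ^+ m.+1 * bcoef j t| <= C * expR (- (1 / 2) * t).
Proof.
have [C1 C10 h1] := bcoef_bound_large m.+1 j.
have [C2 C20 h2] := bcoef_bound_small j.
exists (C1 + C2 * expR (1 / 2)).
  by rewrite addr_ge0// mulr_ge0// expR_ge0.
move=> t t0; rewrite mulrDl; have [t1|t1] := lerP 1 t.
  by rewrite (le_trans (h1 t t1))// lerDl !mulr_ge0// expR_ge0.
apply: (@le_trans _ _ (C2 * expR (1 / 2) * expR (- (1 / 2) * t))); last first.
  by rewrite lerDr mulr_ge0// expR_ge0.
rewrite -mulrA -expRD exprS mulrAC normrM.
apply: (@le_trans _ _ (C2 * 1)).
  apply: ler_pM => //; first exact/h2/ltW.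
  by rewrite normrX gtr0_norm// exprn_ile1// ltW.
by rewrite ler_wpM2l// -[X in X <= _]expR0 ler_expR; lra.
Qed.

Definition moment (j m : nat) : R := \int[mu]_(t in `]0, +oo[) (t ^+ m * bcoef j t).

Lemma momentE m : moment 0 m = IKM R a b m.
Proof. by apply: eq_Rintegral => t _; rewrite bcoef0 mulrC. Qed.

Lemma continuous_bcoef m j (t : R) : 0 < t ->
  {for t, continuous (fun x : R => x ^+ m * bcoef j x)}.
Proof.
move=> t0; exact: (is_derive_continuous
  (is_derive_mul (is_derive_pow m t) (is_derive_bcoef j t0))).
Qed.

Lemma integrable_bcoef m j :
  mu.-integrable `]0, +oo[ (EFin \o (fun t => t ^+ m.+1 * bcoef j t)).
Proof.
have [C C0 hC] := bcoef_bound m j.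
apply: (@le_expRN_integrable _ _ _ C (1 / 2)) => //.
- by move=> t; rewrite /= !in_itv/= !andbT; exact: ltW.
- apply: open_continuous_measurable_fun; first exact: interval_open.
  by move=> t /set_mem/=; rewrite in_itv/= andbT; exact: continuous_bcoef.
- by move=> t; rewrite /= in_itv/= andbT; exact: hC.
Qed.

Lemma moment_gt j m : (n < j)%N -> moment j m = 0.
Proof.
move=> nj; rewrite /moment; under eq_Rintegral do rewrite bcoef_gt// mulr0.
by rewrite /Rintegral integral0.
Qed.

(** The integral of the derivative of t^{m+2} g_j, whose limits at 0 and at
    infinity are 0. *)
Lemma moment_rec j m : m.+2%:R * moment j m.+1 + j.+1%:R * moment j.+1 m.+1 +
  (if j is i.+1 then (n%:R - i%:R) * moment i m.+3 else 0) = 0.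
Proof.
have int_prev : mu.-integrable `]0, +oo[
    (EFin \o (fun t => t ^+ m.+3 * bcoef_prev j t)).
  rewrite /bcoef_prev; case: j => [|i] /=.
    rewrite (_ : (fun _ => _) = cst 0); first exact: integrable0.
    by apply/funext => t; rewrite mulr0.
  rewrite (_ : (fun _ => _) =
    (fun t => (n%:R - i%:R) * (t ^+ m.+3 * bcoef i t))); last first.
    by apply/funext => t; rewrite mulrCA.
  by apply: integrable_realZ => //; exact: integrable_bcoef.
have -> : (if j is i.+1 then (n%:R - i%:R) * moment i m.+3 else 0) =
    \int[mu]_(t in `]0, +oo[) (t ^+ m.+3 * bcoef_prev j t).
  rewrite /bcoef_prev; case: j {int_prev} => [|i] /=.
    by under eq_Rintegral do rewrite mulr0; rewrite /Rintegral integral0.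
  rewrite -RintegralZl//; last exact: integrable_bcoef.
  by apply: eq_Rintegral => t _; rewrite mulrCA.
have int1 k i r : mu.-integrable `]0, +oo[
    (EFin \o (fun t => r * (t ^+ k.+1 * bcoef i t))).
  by apply: integrable_realZ => //; exact: integrable_bcoef.
rewrite /moment -!RintegralZl//; try exact: integrable_bcoef.
rewrite -RintegralD//; try exact: int1.
rewrite -RintegralD//; last by apply: integrable_realD => //; exact: int1.
have dF (t : R) : 0 < t -> is_derive t 1 (fun t => t ^+ m.+2 * bcoef j t)
    (m.+2%:R * (t ^+ m.+1 * bcoef j t) + j.+1%:R * (t ^+ m.+1 * bcoef j.+1 t) +
     t ^+ m.+3 * bcoef_prev j t).
  move=> t0; have h := is_derive_mul (is_derive_pow m.+2 t) (is_derive_bcoef j t0).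
  apply: (is_derive_eq h); rewrite /= !exprS; field; exact: lt0r_neq0.
rewrite (FTC_itv0y dF (l0 := 0) (ly := 0)) ?subrr//.
- move=> t t0; apply: cvgD.
    by apply: cvgD; (apply: cvgM; [exact: cvg_cst|exact: continuous_bcoef]).
  case: (j) => [|i] /=.
    by apply: cvgM; [exact: exprn_continuous|exact: cvg_cst].
  apply: cvgM; first exact: exprn_continuous.
  by apply: cvgM; [exact: cvg_cst|exact: (is_derive_continuous (is_derive_bcoef i t0))].
- by apply: integrable_realD => //; apply: integrable_realD => //; exact: int1.
- have [C C0 hC] := bcoef_bound m j.
  apply: norm_cvg0; apply: (@squeeze_cvgr _ _ _ _ (cst 0) (fun t => t * C)).
  + near=> t; have t0 : 0 < t by near: t; exact: nbhs_right_gt.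
    rewrite normr_ge0/= exprS -mulrA normrM gtr0_norm// ler_wpM2l ?(ltW t0)//.
    rewrite (le_trans (hC t t0))// -[leRHS]mulr1 ler_wpM2l// -[leRHS]expR0 ler_expR.
    by lra.
  + exact: cvg_cst.
  + rewrite -[X in _ --> X](mul0r C); apply: cvg_at_right_filter.
    by apply: cvgM; [exact: cvg_id|exact: cvg_cst].
- have [C C0 hC] := bcoef_bound m.+1 j.
  apply: (@le_expRN_cvgy _ _ C (1 / 2)); first lra.
  by move=> t t1; apply: hC; lra.
Unshelve. all: by end_near. Qed.

(** This is the recursion for j = n with t^{m+2} replaced by t^0: the moment of
    g_n gets the coefficient 0, and g_n contributes its limit at 0. *)
Lemma moment_top : moment n.-1 1 = - (0 ^+ a * (-1) ^+ b).
Proof.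
have nE : n = n.-1.+1 by lia.
have dF (t : R) : 0 < t -> is_derive t 1 (bcoef n) (t ^+ 1 * bcoef n.-1 t).
  move=> t0; apply: (is_derive_eq (is_derive_bcoef n t0)).
  rewrite bcoef_gt// /bcoef_prev nE -nE.
  have -> : n%:R = n.-1%:R + 1 :> R by rewrite natr1 -nE.
  by field; exact: lt0r_neq0.
rewrite /moment (FTC_itv0y dF (l0 := 0 ^+ a * (-1) ^+ b) (ly := 0)) ?sub0r//.
- by move=> t t0; exact: continuous_bcoef.
- exact: integrable_bcoef.
- under eq_fun do rewrite bcoef_top.
  apply: cvgM.
    exact: (continuous_cvg _ (@exprn_continuous R a 0) (@cvg_thetaI R)).
  exact: (continuous_cvg _ (@exprn_continuous R b (-1)) (@cvg_thetaK R)).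
- have [C C0 hC] := bcoef_bound 0 n.
  apply: (@le_expRN_cvgy _ _ C (1 / 2)); first lra.
  move=> t t1; have t0 : 0 < t by lra.
  apply: le_trans (hC t t0); rewrite normrM expr1 (gtr0_norm t0).
  by rewrite ler_peMl.
Qed.

End Moments.

(** * Rational spans of real numbers *)

Section RationalSpan.
Context {R : realType}.
Implicit Types (A B : set R) (x y : R) (q : rat).

Lemma Qspan_mem A x : A x -> Qspan A x.
Proof.
move=> Ax; exists 1%N, (fun=> 1), (fun=> x); split => //.
by rewrite big_ord1 rmorph1 mul1r.
Qed.

Lemma Qspan0 A : Qspan A 0.
Proof.
by exists 0%N, (fun=> 0), (fun=> 0); split; [case|rewrite big_ord0].
Qed.

Lemma QspanD A x y : Qspan A x -> Qspan A y -> Qspan A (x + y).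
Proof.
move=> [m [c [v [Av ->]]]] [n [d [w [Aw ->]]]]; exists (m + n)%N.
exists (fun i => match fintype.split i with inl k => c k | inr k => d k end).
exists (fun i => match fintype.split i with inl k => v k | inr k => w k end).
split; first by move=> i; case: fintype.split.
rewrite big_split_ord/=; congr (_ + _); apply: eq_bigr => i _.
  by rewrite (unsplitK (inl i)).
by rewrite (unsplitK (inr i)).
Qed.

Lemma QspanZ A q x : Qspan A x -> Qspan A (ratr q * x).
Proof.
move=> [m [c [v [Av ->]]]]; exists m, (fun i => q * c i), v; split => //.
by rewrite mulr_sumr; apply: eq_bigr => i _; rewrite rmorphM mulrA.
Qed.

Lemma Qspan_sum A n (c : 'I_n -> rat) (v : 'I_n -> R) :
  (forall i, Qspan A (v i)) -> Qspan A (\sum_(i < n) ratr (c i) * v i).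
Proof.
move=> Av; apply: (big_ind (Qspan A)); [exact: Qspan0|exact: QspanD|].
by move=> i _; exact: QspanZ.
Qed.

Lemma Qspan_subset A B : A `<=` Qspan B -> Qspan A `<=` Qspan B.
Proof. by move=> AB x [n [c [v [Av ->]]]]; apply: Qspan_sum => i; exact: AB. Qed.

Lemma Qspan_range_lift n (e : 'I_n.+1 -> R) (c : 'I_n.+1 -> rat) i :
  c i != 0 -> \sum_j ratr (c j) * e j = 0 ->
  Qspan (range e) = Qspan (range (e \o lift i)).
Proof.
move=> ci0 ce; rewrite eqEsubset; split; apply: Qspan_subset => _ [j _ <-].
  have [k ->|->] := unliftP i j; first by apply: Qspan_mem; exists k.
  have -> : e i = \sum_(k < n) ratr (- c (lift i k) / c i) * e (lift i k).
    have cR0 : ratr (c i) != 0 :> R by rewrite fmorph_eq0.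
    apply: (mulfI cR0); rewrite mulr_sumr.
    move/eqP: ce; rewrite (bigD1_ord i)//= addr_eq0 => /eqP ->.
    rewrite -sumrN; apply: eq_bigr => k _.
    by rewrite !rmorphM rmorphN fmorphV; field.
  by apply: Qspan_sum => k; apply: Qspan_mem; exists k.
by apply: Qspan_mem; exists (lift i j).
Qed.

(** As long as the family is dependent, a member with a nonzero coefficient can
    be removed without changing the span. *)
Lemma Qdim_le_range n (e : 'I_n -> R) : Qdim_le (Qspan (range e)) n.
Proof.
elim: n e => [|n IH] e; have [dep|indep] := pselect (Qdependent e);
  try by exists _, e.
  by case: dep => c [[]].
case: dep => c [i ci0] ce; rewrite (Qspan_range_lift ci0 ce).
have [m [e' [he' mn]]] := IH (e \o lift i).
by exists m, e'; split => //; exact: leqW.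
Qed.

Lemma Qdim_le_span d (c : nat -> R) :
  (forall k, Qspan (range (fun i : 'I_d => c i)) (c k)) ->
  Qdim_le (Qspan (range c)) d.
Proof.
move=> hc; rewrite (_ : Qspan _ = Qspan (range (fun i : 'I_d => c i))).
  exact: Qdim_le_range.
rewrite eqEsubset; split; apply: Qspan_subset => _ [k _ <-]; first exact: hc.
by apply: Qspan_mem; exists (k : nat).
Qed.

End RationalSpan.

(** * Rational recurrences *)

Section ShiftOperators.
Context {R : realType}.
Variable c : nat -> R.

(** The polynomial p in the shift operator, applied to the sequence c: the
    indeterminate acts as the shift ([shiftopX]). *)
Definition shiftop (p : {poly rat}) (k : nat) : R :=
  \sum_(i < size p) ratr p`_i * c (k + i)%N.

Lemma shiftop_widen N (p : {poly rat}) k : (size p <= N)%N ->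
  shiftop p k = \sum_(i < N) ratr p`_i * c (k + i)%N.
Proof.
move=> pN; rewrite /shiftop (big_ord_widen _ (fun i => ratr p`_i * c (k + i)%N) pN).
rewrite big_mkcond; apply: eq_bigr => i _; case: ltnP => // pi.
by rewrite nth_default// rmorph0 mul0r.
Qed.

Lemma shiftopD (p q : {poly rat}) k : shiftop (p + q) k = shiftop p k + shiftop q k.
Proof.
pose N := maxn (size p) (size q).
rewrite (@shiftop_widen N) ?size_polyD// (@shiftop_widen N p) ?leq_maxl//.
rewrite (@shiftop_widen N q) ?leq_maxr// -big_split; apply: eq_bigr => i _.
by rewrite coefD rmorphD mulrDl.
Qed.

Lemma shiftopZ r p k : shiftop (r *: p) k = ratr r * shiftop p k.
Proof.
rewrite (@shiftop_widen (size p)) ?size_scale_leq// mulr_sumr.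
by apply: eq_bigr => i _; rewrite coefZ rmorphM mulrA.
Qed.

Lemma shiftopX p k : shiftop ('X * p) k = shiftop p k.+1.
Proof.
have sX : (size ('X * p)%R <= (size p).+1)%N.
  by rewrite (leq_trans (size_polyMleq _ _))// size_polyX.
rewrite (shiftop_widen _ sX) big_ord_recl coefXM/= rmorph0 mul0r add0r.
by apply: eq_bigr => i _; rewrite coefXM/= addnS.
Qed.

Lemma shiftop1 k : shiftop 1 k = c k.
Proof.
by rewrite /shiftop size_poly1 big_ord1 coef1 rmorph1 mul1r addn0.
Qed.

Lemma Qspan_shiftop A d (p : {poly rat}) k : (size p <= d.+1)%N -> p`_d != 0 ->
  Qspan A (shiftop p k) -> (forall i, (i < d)%N -> Qspan A (c (k + i)%N)) ->
  Qspan A (c (k + d)%N).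
Proof.
move=> sp pd0; rewrite (shiftop_widen k sp) big_ord_recr/= => hp hc.
have pR0 : ratr p`_d != 0 :> R by rewrite fmorph_eq0.
set S := \sum_(i < d) _ in hp.
have hS : Qspan A S by apply: Qspan_sum => i; exact: hc.
have -> : c (k + d)%N =
    ratr (p`_d)^-1 * ((S + ratr p`_d * c (k + d)%N) + ratr (-1) * S).
  by rewrite fmorphV rmorphN rmorph1; field.
by apply/QspanZ/QspanD => //; exact: QspanZ.
Qed.

End ShiftOperators.

Lemma sum_option (V : nmodType) (I : finType) (F : option I -> V) :
  \sum_o F o = F None + \sum_i F (Some i).
Proof.
rewrite (bigD1 None)//=; congr (_ + _); rewrite (reindex_omap Some id)/=.
  by apply: eq_bigl => i; rewrite eqxx.
by case.
Qed.

Section MomentRecursion.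
Context {R : realType}.
Variables (n : nat) (M : nat -> nat -> R).
Hypothesis recM : forall j k, k.*2.+2%:R * M j k + j.+1%:R * M j.+1 k +
  (if j is i.+1 then (n%:R - i%:R) * M i k.+1 else 0) = 0.

(** The recursion lowers j by 1 or 2, the latter with a shift of k, so the degree
    is at most floor(j/2).  The sign of the coefficient of degree floor(j/2)
    is carried along because, for j odd, both terms of the recursion contribute to
    it: they have the same sign, hence do not cancel. *)
Lemma moment_shiftop j : (j <= n.+1)%N -> forall k, exists p : {poly rat},
  [/\ (size p <= j./2.+1)%N, 0 < (-1) ^+ uphalf j * p`_(j./2)
    & M j k = shiftop (M 0) p k].
Proof.
(* the recursion has order two, so the claims for j and j + 1 go together *)
suff H : ((j <= n.+1)%N -> forall k, exists p : {poly rat},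
  [/\ (size p <= j./2.+1)%N, 0 < (-1) ^+ uphalf j * p`_(j./2)
    & M j k = shiftop (M 0) p k]) /\
  ((j < n.+1)%N -> forall k, exists p : {poly rat},
  [/\ (size p <= (uphalf j).+1)%N, 0 < (-1) ^+ (j./2.+1) * p`_(uphalf j)
    & M j.+1 k = shiftop (M 0) p k]) by case: H.
elim: j => [|j [IHj IHj1]]; split.
- by move=> _ k; exists 1; rewrite size_poly1 coef1 mulr1 shiftop1.
- move=> _ k; exists (- k.*2.+2%:R *: 1); split.
  + by rewrite (leq_trans (size_scale_leq _ _))// size_poly1.
  + by rewrite coefZ coef1/= mulr1 expr1 mulN1r opprK ltr0n.
  + rewrite shiftopZ shiftop1 rmorphN rmorph_nat; have := recM 0 k; lra.
- exact: IHj1.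
move=> jn k.
have [p1 [s1 c1 M1]] := IHj1 (ltnW jn) k.
have [p0 [s0 c0 M0]] := IHj (leqW (ltnW jn)) k.+1.
have jn' : (j <= n)%N by lia.
exists (j.+2%:R^-1 *: (- k.*2.+2%:R *: p1 + - (n%:R - j%:R) *: ('X * p0))); split.
- rewrite (leq_trans (size_scale_leq _ _))// (leq_trans (size_polyD _ _))//.
  rewrite geq_max !(leq_trans (size_scale_leq _ _))//.
    by rewrite (leq_trans (size_polyMleq _ _))// size_polyX.
  by rewrite (leq_trans s1)// ltnS; lia.
- rewrite coefZ mulrCA mulr_gt0 ?invr_gt0 ?ltr0n// coefD !coefZ coefXM/=.
  rewrite exprS.
  have nj : 0 < n%:R - j%:R :> rat by rewrite subr_gt0 ltr_nat.
  have k0 : 0 < k.*2.+2%:R :> rat by rewrite ltr0n.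
  have : 0 <= (-1) ^+ uphalf j * p1`_(j./2.+1).
    move: c1 s1; rewrite !uphalf_half; case: (odd j) => /=.
      by rewrite !add1n => /ltW.
    by rewrite add0n => _ s1; rewrite [p1`__]nth_default ?mulr0.
  move: ((-1) ^+ uphalf j) c0 => e; nra.
- rewrite shiftopZ shiftopD !shiftopZ shiftopX -M1 -M0.
  have j0 : j.+2%:R != 0 :> R by rewrite pnatr_eq0.
  apply: (mulfI j0); rewrite mulrA fmorphV !rmorph_nat mulfV// mul1r.
  rewrite !rmorphN rmorphB !rmorph_nat.
  by have := recM j.+1 k; lra.
Qed.

End MomentRecursion.

(** * Relations between Bessel moments *)

Section BesselMomentRelations.
Context {R : realType}.
Variables (a b : nat).
Hypothesis ab : (a < b)%N.
Local Notation n := (a + b)%N.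
Local Notation c := (fun k : nat => IKM R a b k.*2.+1).

Lemma IKM_shiftop j : (j <= n.+1)%N -> forall k, exists p : {poly rat},
  [/\ (size p <= j./2.+1)%N, p`_(j./2) != 0
    & @moment R a b j k.*2.+1 = shiftop c p k].
Proof.
move=> jn k.
have rec i l := @moment_rec R a b ab i l.*2.
have [p [sp p0 hp]] :=
  @moment_shiftop R n (fun i l => @moment R a b i l.*2.+1) rec j jn k.
exists p; split => //; first by apply: contraTneq p0 => ->; rewrite mulr0 ltxx.
by rewrite hp /shiftop; apply: eq_bigr => i _; rewrite momentE.
Qed.

Lemma IKM_rec k : exists p : {poly rat},
  [/\ (size p <= (n.-1)./2.+2)%N, p`_((n.-1)./2.+1) != 0 & shiftop c p k = 0].
Proof.
have [p [sp p0 hp]] := IKM_shiftop (leqnn n.+1) k.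
have E : n.+1./2 = (n.-1)./2.+1 by lia.
by exists p; rewrite -E -hp moment_gt.
Qed.

Lemma IKM_extra : exists p : {poly rat},
  [/\ (size p <= (n.-1)./2.+1)%N, p`_((n.-1)./2) != 0 &
      shiftop c p 0 = - (0 ^+ a * (-1) ^+ b)].
Proof.
have [p [sp p0 hp]] := @IKM_shiftop n.-1 ltac:(lia) 0.
exists p; split => //; rewrite -hp; exact: moment_top.
Qed.

Lemma Qspan_IKM (A : set R) :
  (forall i, (i <= (n.-1)./2)%N -> Qspan A (c i)) -> forall k, Qspan A (c k).
Proof.
move=> Ac; elim/ltn_ind => k IH; have [/Ac//|kn] := leqP k (n.-1)./2.
have [p [sp p0 hp]] := IKM_rec (k - (n.-1)./2.+1).
have kE : k = (k - (n.-1)./2.+1 + (n.-1)./2.+1)%N by rewrite subnK.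
rewrite kE; apply: (Qspan_shiftop (c := c) sp p0).
  by rewrite hp; exact: Qspan0.
by move=> i id; apply: IH; lia.
Qed.

End BesselMomentRelations.

(* An integer k lies in [0, x/2] iff k < x./2.+1; hence the ordinal index types.
   In (ii), the index [None] of the option type carries the extra element 1. *)
Theorem theorem1p2 (R : realType) :
  (forall a b : nat, (2 <= b)%N -> (1 <= a)%N -> (a < b)%N ->
     Qdependent (fun k : 'I_((a + b - 1)./2.+1) => IKM R a b k.*2.+1)
     /\ Qdim_le (Qspan (range (fun k : nat => IKM R a b k.*2.+1)))
          (a + b - 1)./2)
  /\
  (forall n : nat, (2 <= n)%N ->
     Qdependent (fun o : option 'I_((n - 1)./2.+1) =>
                   if o is Some k then IKM R 0 n k.*2.+1 else 1)
     /\ Qdim_le (Qspan (range (fun k : nat => IKM R 0 n k.*2.+1)))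
          (n + 1)./2).
Proof.
split=> [a b b2 a1 ab|n n2].
  have [p [sp p0 hp]] := @IKM_extra R a b ab.
  rewrite subn1; split.
    exists (fun i : 'I_((a + b).-1./2.+1) => p`_i); first by exists ord_max.
    rewrite -(shiftop_widen (fun k => IKM R a b k.*2.+1) 0 sp) hp.
    by rewrite expr0n eqn0Ngt a1 mul0r oppr0.
  apply: Qdim_le_span => k; apply: (Qspan_IKM ab) => i ih.
  have below l : (l < (a + b).-1./2)%N -> Qspan
      (range (fun i : 'I_((a + b).-1./2) => IKM R a b i.*2.+1)) (IKM R a b l.*2.+1).
    by move=> lh; apply: Qspan_mem; exists (Ordinal lh).
  move: ih; rewrite leq_eqVlt => /predU1P[->|]; last exact: below.
  apply: (Qspan_shiftop (c := fun k => IKM R a b k.*2.+1) (k := 0) sp p0) => //.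
  by rewrite hp expr0n eqn0Ngt a1 mul0r oppr0; exact: Qspan0.
have [p [sp p0 hp]] := @IKM_extra R 0 n (ltnW n2).
rewrite subn1 addn1; split.
  exists (fun o : option 'I_(n.-1./2.+1) => if o is Some k then p`_k else (-1) ^+ n).
    by exists (Some ord_max).
  rewrite sum_option/= -(shiftop_widen (fun k => IKM R 0 n k.*2.+1) 0 sp) hp.
  by rewrite rmorphXn rmorphN rmorph1; ring.
apply: Qdim_le_span => k; apply: (Qspan_IKM (ltnW n2)) => i ih.
have ih' : (i < n.+1./2)%N by move: ih; rewrite add0n; lia.
by apply: Qspan_mem; exists (Ordinal ih').
Qed.
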